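(* Let $L_5$ be the $3$-dimensional complex Lie algebra with basis $z_1,z_2,z_3$ whose only nonzero bracket (up to antisymmetry) is $[z_3,z_1]=z_2$. There are no subalgebras of $\mathfrak{so}(4,\mathbb{C})$ isomorphic to $L_5$.
   Context: $\mathfrak{so}(4,\mathbb{C})\cong\mathfrak{sl}(2,\mathbb{C})\oplus\mathfrak{sl}(2,\mathbb{C})$ is realized as the Lie algebra of $4\times4$ complex block diagonal matrices with two traceless $2\times 2$ diagonal blocks. Subalgebras are complex Lie subalgebras. *)

(* Defs.v *)
From HB Require Import structures.
From mathcomp Require Import all_boot all_order all_algebra ring.

Set Implicit Arguments.
Unset Strict Implicit.
Unset Printing Implicit Defensive.

Import GRing.Theory.
Local Open Scope ring_scope.

(* Finite-dimensional Lie algebras over a field: a vector space together with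
   a bilinear, alternating bracket satisfying the Jacobi identity. *)
HB.mixin Record Vector_isLie (K : fieldType) (L : Type) of Vector K L := {
  lie : L -> L -> L;
  lie_linearl : forall (a : K) (x y z : L),
    lie (a *: x + y) z = a *: lie x z + lie y z;
  lie_linearr : forall (a : K) (x y z : L),
    lie x (a *: y + z) = a *: lie x y + lie x z;
  liexx : forall x : L, lie x x = 0;
  lie_jacobi : forall x y z : L,
    lie x (lie y z) + lie y (lie z x) + lie z (lie x y) = 0
}.

#[short(type="lieAlgType")]
HB.structure Definition LieAlg (K : fieldType) :=
  { L of Vector K L & Vector_isLie K L }.

Definition lie_isomorphic (K : fieldType) (L1 L2 : lieAlgType K) : Prop :=
  exists f : {linear L1 -> L2},
    bijective f /\ forall x y : L1, f (lie x y) = lie (f x) (f y).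

Record lieSubalg (K : fieldType) (L : lieAlgType K) := LieSubalg {
  lieSubalg_space :> {vspace L};
  lieSubalg_closed : forall x y : L,
    x \in lieSubalg_space -> y \in lieSubalg_space ->
    lie x y \in lieSubalg_space
}.

(* A subalgebra is a Lie algebra in its own right, with the induced bracket. *)
Definition lie_sub (K : fieldType) (L : lieAlgType K) (U : lieSubalg L) : Type :=
  subvs_of U.

Section LieSub.
Variables (K : fieldType) (L : lieAlgType K) (U : lieSubalg L).

HB.instance Definition _ := Vector.copy (lie_sub U) (subvs_of U).

Definition sub_lie (x y : lie_sub U) : lie_sub U :=
  Subvs (lieSubalg_closed (subvsP x) (subvsP y)).

Fact sub_lie_linearl (a : K) (x y z : lie_sub U) :
  sub_lie (a *: x + y) z = a *: sub_lie x z + sub_lie y z.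
Proof. by apply: val_inj; rewrite /= lie_linearl. Qed.

Fact sub_lie_linearr (a : K) (x y z : lie_sub U) :
  sub_lie x (a *: y + z) = a *: sub_lie x y + sub_lie x z.
Proof. by apply: val_inj; rewrite /= lie_linearr. Qed.

Fact sub_liexx (x : lie_sub U) : sub_lie x x = 0.
Proof. by apply: val_inj; rewrite /= liexx. Qed.

Fact sub_lie_jacobi (x y z : lie_sub U) :
  sub_lie x (sub_lie y z) + sub_lie y (sub_lie z x) +
    sub_lie z (sub_lie x y) = 0.
Proof. by apply: val_inj; rewrite /= lie_jacobi. Qed.

HB.instance Definition _ := Vector_isLie.Build K (lie_sub U)
  sub_lie_linearl sub_lie_linearr sub_liexx sub_lie_jacobi.

End LieSub.

(* Square matrices with the commutator bracket; an alias, so that the matrix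
   type itself carries no Lie structure. *)
Definition gl (K : fieldType) (n : nat) : Type := 'M[K]_n.

Section Gl.
Variables (K : fieldType) (n : nat).

HB.instance Definition _ := Vector.copy (gl K n) 'M[K]_n.

Definition mx_lie (A B : gl K n) : gl K n := A *m B - B *m A.

Fact mx_lie_linearl (a : K) (x y z : gl K n) :
  mx_lie (a *: x + y) z = a *: mx_lie x z + mx_lie y z.
Proof.
rewrite /mx_lie mulmxDl mulmxDr -scalemxAl -scalemxAr scalerBr opprD.
by rewrite addrACA.
Qed.

Fact mx_lie_linearr (a : K) (x y z : gl K n) :
  mx_lie x (a *: y + z) = a *: mx_lie x y + mx_lie x z.
Proof.
rewrite /mx_lie mulmxDl mulmxDr -scalemxAl -scalemxAr scalerBr opprD.
by rewrite addrACA.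
Qed.

Fact mx_liexx (x : gl K n) : mx_lie x x = 0.
Proof. exact: subrr. Qed.

Fact mx_lie_jacobi (x y z : gl K n) :
  mx_lie x (mx_lie y z) + mx_lie y (mx_lie z x) + mx_lie z (mx_lie x y) = 0.
Proof.
rewrite /mx_lie !mulmxBl !mulmxBr !mulmxA; apply/matrixP=> i j.
by rewrite !mxE; ring.
Qed.

HB.instance Definition _ := Vector_isLie.Build K (gl K n)
  mx_lie_linearl mx_lie_linearr mx_liexx mx_lie_jacobi.

End Gl.

Section So4.
Variable K : fieldType.

(* As a subspace, so(4) is the common kernel of the two off-diagonal blocks and
   of the traces of the two diagonal blocks; see so4P. *)
Definition so4_space : {vspace gl K (2 + 2)} :=
  (lker (linfun (@ursubmx K 2 2 2 2 : gl K (2 + 2) -> _))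
   :&: lker (linfun (@dlsubmx K 2 2 2 2 : gl K (2 + 2) -> _))
   :&: lker (linfun (fun M : gl K (2 + 2) =>
                       \tr (@ulsubmx K 2 2 2 2 M) : K^o))
   :&: lker (linfun (fun M : gl K (2 + 2) =>
                       \tr (@drsubmx K 2 2 2 2 M) : K^o)))%VS.

Lemma so4P (M : gl K (2 + 2)) :
  reflect (exists A B : 'M[K]_2,
             [/\ \tr A = 0, \tr B = 0 & M = block_mx A 0 0 B])
          (M \in so4_space).
Proof.
rewrite !memv_cap !memv_ker.
have lul : linear (fun N : gl K (2 + 2) =>
    \tr (@ulsubmx K 2 2 2 2 N) : K^o).
  by move=> a x y; rewrite /ulsubmx !linearP.
have ldr : linear (fun N : gl K (2 + 2) =>
    \tr (@drsubmx K 2 2 2 2 N) : K^o).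
  by move=> a x y; rewrite /drsubmx !linearP.
have lur : linear (@ursubmx K 2 2 2 2 : gl K (2 + 2) -> _).
  by move=> a x y; rewrite /ursubmx !linearP.
have ldl : linear (@dlsubmx K 2 2 2 2 : gl K (2 + 2) -> _).
  by move=> a x y; rewrite /dlsubmx !linearP.
pose ful := GRing.isLinear.Build K _ _ _ _ lul.
pose fdr := GRing.isLinear.Build K _ _ _ _ ldr.
pose fur := GRing.isLinear.Build K _ _ _ _ lur.
pose fdl := GRing.isLinear.Build K _ _ _ _ ldl.
pose Ful : {linear gl K (2 + 2) -> K^o} := HB.pack (fun N : gl K (2 + 2) =>
    \tr (@ulsubmx K 2 2 2 2 N) : K^o) ful.
pose Fdr : {linear gl K (2 + 2) -> K^o} := HB.pack (fun N : gl K (2 + 2) =>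
    \tr (@drsubmx K 2 2 2 2 N) : K^o) fdr.
pose Fur : {linear gl K (2 + 2) -> 'M[K]_2} :=
  HB.pack (@ursubmx K 2 2 2 2 : gl K (2 + 2) -> _) fur.
pose Fdl : {linear gl K (2 + 2) -> 'M[K]_2} :=
  HB.pack (@dlsubmx K 2 2 2 2 : gl K (2 + 2) -> _) fdl.
rewrite -[linfun _ M]/(linfun Fur M).
rewrite -[X in _ && (X == _) && _ && _]/(linfun Fdl M).
rewrite -[X in _ && (X == _) && _]/(linfun Ful M).
rewrite -[X in _ && (X == _)]/(linfun Fdr M).
rewrite !lfunE /=.
apply: (iffP idP) => [/andP[/andP[/andP[/eqP ur /eqP dl] /eqP ul] /eqP dr]|].
  exists (ulsubmx M), (drsubmx M); split=> //.
  by rewrite -[LHS](@submxK K 2 2 2 2) ur dl.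
case=> A [B [trA trB ->]].
by rewrite block_mxKur block_mxKdl block_mxKul block_mxKdr trA trB !eqxx.
Qed.

Fact so4_closed (x y : gl K (2 + 2)) :
  x \in so4_space -> y \in so4_space -> lie x y \in so4_space.
Proof.
move=> /so4P[A [B [_ _ ->]]] /so4P[C [D [_ _ ->]]]; apply/so4P.
exists (A *m C - C *m A), (B *m D - D *m B); split.
- by rewrite linearB /= mxtrace_mulC subrr.
- by rewrite linearB /= mxtrace_mulC subrr.
rewrite /lie /= /mx_lie !mulmx_block !mulmx0 !mul0mx !addr0 !add0r.
by rewrite opp_block_mx add_block_mx !oppr0 !addr0.
Qed.

Definition so4_subalg : lieSubalg (gl K (2 + 2)) := LieSubalg so4_closed.

End So4.

Notation so4 K := (lie_sub (so4_subalg K)).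

(* L5: z1, z2, z3 are the standard basis vectors, indexed from 0. *)
Definition L5 (K : fieldType) : Type := 'rV[K]_3.

Section L5.
Variable K : fieldType.

HB.instance Definition _ := Vector.copy (L5 K) 'rV[K]_3.

Definition z1 : L5 K := delta_mx 0 0.
Definition z2 : L5 K := delta_mx 0 1.
Definition z3 : L5 K := delta_mx 0 2.

Definition L5_lie (x y : L5 K) : L5 K :=
  (x 0 2 * y 0 0 - x 0 0 * y 0 2) *: z2.

Fact L5_lie_linearl (a : K) (x y z : L5 K) :
  L5_lie (a *: x + y) z = a *: L5_lie x z + L5_lie y z.
Proof.
by rewrite /L5_lie scalerA -scalerDl !mxE; congr (_ *: _); ring.
Qed.

Fact L5_lie_linearr (a : K) (x y z : L5 K) :
  L5_lie x (a *: y + z) = a *: L5_lie x y + L5_lie x z.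
Proof.
by rewrite /L5_lie scalerA -scalerDl !mxE; congr (_ *: _); ring.
Qed.

Fact L5_liexx (x : L5 K) : L5_lie x x = 0.
Proof. by rewrite /L5_lie mulrC subrr scale0r. Qed.

Fact L5_lie_jacobi (x y z : L5 K) :
  L5_lie x (L5_lie y z) + L5_lie y (L5_lie z x) + L5_lie z (L5_lie x y) = 0.
Proof.
suff lie0 u c : L5_lie u (c *: z2) = 0 by rewrite !lie0 !addr0.
by rewrite /L5_lie !mxE /= !mulr0 subrr scale0r.
Qed.

HB.instance Definition _ := Vector_isLie.Build K (L5 K)
  L5_lie_linearl L5_lie_linearr L5_liexx L5_lie_jacobi.

Lemma L5_basis : basis_of fullv [:: z1; z2; z3].
Proof.
rewrite basisEdim dimvf /dim /= andbT; apply/subvP=> u _.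
have ->: u = u 0 0 *: z1 + u 0 1 *: z2 + u 0 2 *: z3.
  apply/rowP=> i; rewrite !mxE /=.
  case: i => [[|[|[|i]]] lti] //=; rewrite ?(mulr1, mulr0, addr0, add0r);
    by congr (u _ _); apply: val_inj.
by rewrite !memvD ?memvZ // memv_span // !inE eqxx ?orbT.
Qed.

Lemma L5_brackets : [/\ lie z3 z1 = z2, lie z1 z2 = 0 & lie z2 z3 = 0].
Proof.
by split; rewrite /lie /= /L5_lie !mxE /= ?(mulr0, mul0r, mulr1, subr0);
  rewrite ?(scale1r, scale0r, subrr).
Qed.

End L5.

(* Main.v *)
(* The block projections turn a copy of L5 into two triples x, z, y = [z, x] of
   2 x 2 matrices in which y commutes with x and z.  If y is not scalar, its
   centralizer consists of the combinations of 1 and y, hence is commutative and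
   y = [z, x] = 0; if y is scalar, then 2 y = 0 because y has trace 0.  So both
   blocks of y vanish, whereas z2 is nonzero. *)
Require Import Defs.
From mathcomp Require Import all_boot all_order all_algebra.
From mathcomp Require Import complex reals.
From mathcomp Require Import ring.

Import GRing.Theory Num.Theory.
Local Open Scope ring_scope.

(** Being parallel to a common vector is transitive when [y1] is nonzero: multiplied by [y1], both
    sides become [y2 * w1 * x1]. *)
Lemma parallel_minor0 (K : idomainType) (y1 y2 x1 x2 w1 w2 : K) :
  y1 != 0 -> y1 * x2 = y2 * x1 -> y1 * w2 = y2 * w1 -> w1 * x2 = w2 * x1.
Proof.
move=> nz_y1 x12 w12; apply: (mulfI nz_y1).
by rewrite mulrCA x12 [RHS]mulrA w12; ring.
Qed.

(** Modulo scalars, [M] is the vector [(M 0 1, M 0 0 - M 1 1, M 1 0)]. Up to sign, the entries of a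
    commutator are the minors of two such vectors, so commuting means being parallel. *)
Lemma gl2_commutatorE (K : fieldType) (A B : gl K 2) :
  [/\ lie A B 0 0 = A 0 1 * B 1 0 - A 1 0 * B 0 1,
      lie A B 0 1 = (A 0 0 - A 1 1) * B 0 1 - A 0 1 * (B 0 0 - B 1 1),
      lie A B 1 0 = A 1 0 * (B 0 0 - B 1 1) - (A 0 0 - A 1 1) * B 1 0
    & lie A B 1 1 = - lie A B 0 0].
Proof.
have lift1 : lift ord0 ord0 = 1 :> 'I_2 by apply: val_inj.
by rewrite /lie /= /mx_lie !mxE !big_ord_recl !big_ord0 lift1; split; ring.
Qed.

Lemma gl2_central_commutator0 (K : fieldType) (X Z : gl K 2) :
  2 != 0 :> K ->
  lie X (lie Z X) = 0 -> lie (lie Z X) Z = 0 -> lie Z X = 0.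
Proof.
move=> nz2; have := gl2_commutatorE K Z X; move: (lie Z X) => Y.
move=> [y00 y01 y10 y11] XY YZ.
pose d (M : gl K 2) := M 0 0 - M 1 1.
have [_] := gl2_commutatorE K X Y; rewrite XY !mxE -!/(d _).
move=> /esym/subr0_eq xy01 /esym/subr0_eq xy10 _.
have [_] := gl2_commutatorE K Y Z; rewrite YZ !mxE -!/(d _).
move=> /esym/subr0_eq yz01 /esym/subr0_eq yz10 _.
rewrite -!/(d _) in y01 y10.
(* Were this entry nonzero, the vectors of [X] and [Z] would both be parallel to that of [Y]; but
   [Y 0 1] is itself one of their minors. The same works for [Y 1 0]. *)
have Y01 : Y 0 1 = 0.
  apply/eqP/negPn/negP => nz.
  have minor0 : Z 0 1 * d X = d Z * X 0 1.
    apply: (@parallel_minor0 _ (Y 0 1) (d Y)) => //.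
    by rewrite mulrC xy01 mulrC.
  by rewrite y01 minor0 subrr eqxx in nz.
have Y10 : Y 1 0 = 0.
  apply/eqP/negPn/negP => nz.
  have minor0 : Z 1 0 * d X = d Z * X 1 0.
    apply: (@parallel_minor0 _ (Y 1 0) (d Y)) => //.
    by rewrite mulrC -xy10 mulrC.
  by rewrite y10 minor0 subrr eqxx in nz.
have Y00 : Y 0 0 = 0.
  apply/eqP/negPn/negP => nz.
  (* Since [Y] has trace 0, [d Y] is [2 * Y 0 0]. *)
  have nz_dY : d Y != 0 by rewrite /d y11 opprK -mulr2n -mulr_natl mulf_neq0.
  have cancel_dY t : t * d Y = 0 -> t = 0.
    by move=> /eqP; rewrite mulf_eq0 (negPf nz_dY) orbF => /eqP.
  (* [Y] is now diagonal with distinct entries, so [X], commuting with it, is diagonal too. *)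
  have X01 : X 0 1 = 0 by apply: cancel_dY; rewrite -xy01 Y01 mulr0.
  have X10 : X 1 0 = 0 by apply: cancel_dY; rewrite xy10 Y10 mulr0.
  by rewrite y00 X01 X10 !mulr0 subrr eqxx in nz.
have Y11 : Y 1 1 = 0 by rewrite y11 Y00 oppr0.
have ord2 (i : 'I_2) : i = 0 \/ i = 1.
  by case: i => [[|[|//]] ?]; [left | right]; apply: val_inj.
by apply/matrixP=> i j; rewrite mxE; case: (ord2 i) (ord2 j) => -> [] ->.
Qed.

Lemma lie_block_diag (K : fieldType) (m n : nat)
    (A C : gl K m) (B D : gl K n) :
  lie (block_mx A 0 0 B : gl K (m + n)) (block_mx C 0 0 D : gl K (m + n)) =
  block_mx (lie A C) 0 0 (lie B D).
Proof.
rewrite /lie /= /mx_lie !mulmx_block !mulmx0 !mul0mx !addr0 !add0r.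
by rewrite opp_block_mx add_block_mx !oppr0 !addr0.
Qed.

Lemma block_diag_eq0 (K : fieldType) (m n : nat) (A : gl K m) (B : gl K n) :
  block_mx A 0 0 B = 0 :> gl K (m + n) -> A = 0 /\ B = 0.
Proof. by rewrite -[RHS](@block_mx0 K m n m n) => /eq_block_mx[]. Qed.

Lemma so4_central_commutator0 (K : fieldType) (x z : so4 K) :
  2 != 0 :> K ->
  lie x (lie z x) = 0 -> lie (lie z x) z = 0 -> lie z x = 0.
Proof.
move=> nz2 /(congr1 val) xy /(congr1 val) yz; apply: val_inj; move: xy yz => /=.
have /so4P[A [B [_ _ ->]]] := subvsP x.
have /so4P[C [D [_ _ ->]]] := subvsP z.
rewrite !lie_block_diag => /block_diag_eq0[AY BY] /block_diag_eq0[YC YD].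
rewrite (gl2_central_commutator0 _ _ _ nz2 AY YC).
rewrite (gl2_central_commutator0 _ _ _ nz2 BY YD).
exact: (@block_mx0 K 2 2 2 2).
Qed.

Theorem theorem5p8 (R : realType) :
  ~ exists U : lieSubalg (so4 R[i]), lie_isomorphic (lie_sub U) (L5 R[i]).
Proof.
case=> U [f [[g fK gK] f_lie]].
have [z31 z12 z23] := L5_brackets R[i].
(* The inverse [g] comes as a bare function, so its compatibility with brackets and zero is pulled
   back from [f]. *)
have g_lie u v : lie (g u) (g v) = g (lie u v).
  by apply: (can_inj fK); rewrite f_lie !gK.
have g0 : g 0 = 0 by apply: (can_inj fK); rewrite gK linear0.
have y_def : val (g (z2 R[i])) = lie (val (g (z3 _))) (val (g (z1 _))).
  by rewrite -z31 -g_lie.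
(* In [L5], [z2] is both the bracket of [z3] and [z1] and central, which is the situation excluded
   in [so4]. *)
have y0 : g (z2 R[i]) = 0.
  apply: val_inj; rewrite y_def; apply: so4_central_commutator0.
  - by rewrite pnatr_eq0.
  - by rewrite -y_def -[LHS]/(val (lie (g _) (g _))) g_lie z12 g0.
  - by rewrite -y_def -[LHS]/(val (lie (g _) (g _))) g_lie z23 g0.
have := congr1 f y0; rewrite gK linear0 => /matrixP/(_ 0 1)/eqP.
by rewrite !mxE /= oner_eq0.
Qed.
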